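(* Let $A$ be a subset of $(\mathbb{Z}/3\mathbb{Z})^n$ containing no three-term arithmetic progression. Then $|A| = o(2.756^n)$ as $n \to \infty$. That is, if $r_3((\mathbb{Z}/3\mathbb{Z})^n)$ denotes the maximal size of a subset of $(\mathbb{Z}/3\mathbb{Z})^n$ containing no three-term arithmetic progression, then $$\lim_{n\to\infty} \frac{r_3((\mathbb{Z}/3\mathbb{Z})^n)}{2.756^n} = 0.$$
   Context: A three-term arithmetic progression in an abelian group $G$ means a nontrivial one: elements $a,\ a+h,\ a+2h$ of $G$ with $h \neq 0$. The constant $2.756$ is the exact decimal $2756/1000$. *)

(* Defs.v *)
From HB Require Import structures.
From mathcomp Require Import all_boot all_order all_algebra.
From mathcomp Require Import all_classical all_reals all_analysis.

Set Implicit Arguments.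
Unset Strict Implicit.
Unset Printing Implicit Defensive.

Import Order.TTheory GRing.Theory Num.Theory.
Import numFieldNormedType.Exports.

Local Open Scope ring_scope.

(* Nontriviality of a progression means h != 0 only, so in a group with
   2-torsion the three terms need not be distinct. *)
Definition ap3_free (G : finZmodType) (A : {set G}) : bool :=
  [forall a : G, forall h : G,
    (h != 0) ==> ~~ [&& a \in A, a + h \in A & a + h *+ 2 \in A]].

(* The index set contains set0, so the default value 0 of \max plays no role. *)
Definition r3 (G : finZmodType) : nat :=
  (\max_(A : {set G} | ap3_free A) #|A|)%N.

(* Main.v *)
(* The slice rank proof of the Ellenberg-Gijswijt bound: for a progression-free
   set A, the indicator of x + y + z = 0 restricted to A^3 is the diagonal
   tensor, which cannot be written with fewer than #|A| slices. Over F_3 this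
   indicator is the product over the coordinates of 1 - (x + y + z)^2, so every
   monomial has total degree at most 2n, hence degree at most 2n/3 in one of the
   three variables. This gives #|A| <= 3N with N the number of exponent vectors
   in {0,1,2}^n of degree at most 2n/3, and N is exponentially small compared
   with 2.756^n. *)
Require Import Defs.
From HB Require Import structures.
From mathcomp Require Import all_boot all_order all_algebra.
From mathcomp Require Import all_classical all_reals all_analysis.
From mathcomp Require Import ring lra zify.

Set Implicit Arguments.
Unset Strict Implicit.
Unset Printing Implicit Defensive.

Import Order.TTheory GRing.Theory Num.Theory.
Import numFieldNormedType.Exports.

Local Open Scope classical_set_scope.
Local Open Scope ring_scope.

(** The left kernel of [M] has dimension [r >= m - a]. A matrix whose rows form a basis of it has
    [r] independent columns, and on these the coordinates of a kernel vector can be prescribed at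
    will. *)
Lemma large_support_orthogonal (F : fieldType) (m a : nat) (M : 'M[F]_(m, a)) :
  exists (r : nat) (s : 'I_r -> 'I_m) (h : 'rV[F]_m),
    [/\ (m <= r + a)%N, injective s, h *m M = 0
      & forall k, h 0 (s k) = 1].
Proof.
pose K := row_base (kermx M).
have fullK : row_full K^T by rewrite /row_full mxrank_tr; exact: row_base_free.
pose s := fullrankfun fullK.
have unitB : colsub s K \in unitmx.
  by rewrite -unitmx_tr trmx_mxsub; exact: fullrowsub_unit.
have [v vB] : exists v : 'rV[F]_(\rank (kermx M)), v *m colsub s K = const_mx 1.
  by exists (const_mx 1 *m invmx (colsub s K)); rewrite mulmxKV.
exists (\rank (kermx M)), s, (v *m K); split.
- have := rank_leq_col M; rewrite mxrank_ker => ?; lia.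
- exact: fullrankfun_inj.
- have KM : K *m M = 0 by apply/sub_kermxP; rewrite eq_row_base.
  by rewrite -mulmxA KM mulmx0.
- move=> k; rewrite mulmx_colsub in vB.
  by move/(congr1 (fun w : 'rV_(_) => w 0 k)): vB; rewrite !mxE.
Qed.

(* Tao's lemma: contracting the first variable with a vector h orthogonal to
   all the f1 i turns the tensor into the diagonal matrix of h, of rank at least
   m - a1, while the remaining slices contribute rank at most a2 + a3. *)
Lemma slice_rank_diag (F : fieldType) (m a1 a2 a3 : nat)
    (f1 : 'I_a1 -> 'I_m -> F) (g1 : 'I_a1 -> 'I_m -> 'I_m -> F)
    (f2 : 'I_a2 -> 'I_m -> F) (g2 : 'I_a2 -> 'I_m -> 'I_m -> F)
    (f3 : 'I_a3 -> 'I_m -> F) (g3 : 'I_a3 -> 'I_m -> 'I_m -> F) :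
  (forall x y z, ((x == y) && (y == z))%:R =
     \sum_i f1 i x * g1 i y z + \sum_i f2 i y * g2 i x z
     + \sum_i f3 i z * g3 i x y) ->
  (m <= a1 + a2 + a3)%N.
Proof.
move=> diagE.
have [r [s [h [m_le s_inj hM hs]]]] :=
  large_support_orthogonal (\matrix_(x, i) f1 i x).
have hf1 i : \sum_x h 0 x * f1 i x = 0.
  transitivity ((h *m \matrix_(x, i) f1 i x) 0 i); last by rewrite hM mxE.
  by rewrite mxE; apply: eq_bigr => x _; rewrite mxE.
pose P2 : 'M[F]_(m, a2) := \matrix_(y, i) f2 i y.
pose Q2 : 'M[F]_(a2, m) := \matrix_(i, z) \sum_x h 0 x * g2 i x z.
pose P3 : 'M[F]_(m, a3) := \matrix_(y, i) \sum_x h 0 x * g3 i x y.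
pose Q3 : 'M[F]_(a3, m) := \matrix_(i, z) f3 i z.
have DE : diag_mx h = P2 *m Q2 + P3 *m Q3.
  apply/matrixP => y z; rewrite !mxE.
  transitivity (\sum_x h 0 x * ((x == y) && (y == z))%:R).
    rewrite (bigD1 y) //= eqxx /= big1 ?addr0 ?mulr_natr //.
    by move=> x /negPf ->; rewrite mulr0.
  under eq_bigr => x _ do rewrite diagE !mulrDr !mulr_sumr.
  rewrite !big_split /= exchange_big big1 /= => [|i _]; last first.
    under eq_bigr => x _ do rewrite mulrA.
    by rewrite -mulr_suml hf1 mul0r.
  rewrite add0r; congr (_ + _); rewrite exchange_big /=; apply: eq_bigr => i _;
    rewrite !mxE ?mulr_sumr ?mulr_suml; apply: eq_bigr => x _; ring.
have rankD : (\rank (diag_mx h) <= a2 + a3)%N.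
  rewrite DE (leq_trans (mxrank_add _ _)) // leq_add //.
    exact: leq_trans (mxrankM_maxl _ _) (rank_leq_col _).
  exact: leq_trans (mxrankM_maxl _ _) (rank_leq_col _).
(* Lower bound on the rank: a submatrix has rank at most that of the whole, and the one selected by
   [s] is the identity of size [r]. *)
have subD : mxsub s s (diag_mx h) = 1%:M.
  by apply/matrixP => i j; rewrite !mxE (inj_eq s_inj) hs.
have r_le : (r <= \rank (diag_mx h))%N.
  rewrite -[r in (r <= _)%N](mxrank1 F) -subD -{1}[diag_mx h]mulmx1 mxsub_mul.
  by rewrite (leq_trans (mxrankM_maxl _ _)) // rowsubE mxrankM_maxr.
lia.
Qed.

(** Collects the terms sharing the factor [a (e i)] into a single slice, so that the number of
    slices is [#|L|] however many terms there are. *)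
Lemma sum_fiber (R : pzSemiRingType) (I J : finType) (P : pred I) (L : {set J})
    (e : I -> J) (a : J -> R) (b : I -> R) :
  (forall i, P i -> e i \in L) ->
  \sum_(i | P i) a (e i) * b i =
  \sum_(k < #|L|) a (enum_val k) * \sum_(i | P i && (e i == enum_val k)) b i.
Proof.
move=> PL; rewrite (partition_big e (mem L)) //= big_enum_val.
apply: eq_bigr => k _; rewrite mulr_sumr; apply: eq_bigr => i /andP[_ /eqP ->].
by [].
Qed.

(** Coefficients of 1 - (x + y + z)^2: squares get -1, and mixed products get -2, which is 1 in
    ['F_3]. *)
Definition delta_coef (p : 'I_3 * 'I_3 * 'I_3) : 'F_3 :=
  if (p.1.1 + p.1.2 + p.2)%N is 0%N then 1
  else if (p.1.1 + p.1.2 + p.2 == 2)%N then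
    if [|| p.1.1 == 2%N :> nat, p.1.2 == 2%N :> nat | p.2 == 2%N :> nat]
    then -1 else 1
  else 0.

Lemma delta_coef_neq0 p : delta_coef p != 0 -> (p.1.1 + p.1.2 + p.2 <= 2)%N.
Proof. by rewrite /delta_coef; case: (_ + _ + _)%N => [|[|[|k]]]; rewrite ?eqxx. Qed.

(* The right-hand side is 1 - (x + y + z) ^+ 2, expanded. *)
Lemma delta_expansion (x y z : 'F_3) :
  (x + y + z == 0)%:R =
  \sum_p delta_coef p * (x ^+ p.1.1 * y ^+ p.1.2 * z ^+ p.2) :> 'F_3.
Proof.
transitivity (\sum_i \sum_j \sum_k
  delta_coef (i, j, k) * (x ^+ i * y ^+ j * z ^+ k)); last first.
  by rewrite !pair_bigA /=; apply: eq_bigr => -[[i j] k].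
rewrite !big_ord_recl !big_ord0 /delta_coef /=.
by apply/val_inj; case: x y z => [[|[|[|x]]] ?] [[|[|[|y]]] ?] [[|[|[|z]]] ?];
  vm_compute.
Qed.

Definition monomial n (x : 'rV['F_3]_n) (e : {ffun 'I_n -> 'I_3}) : 'F_3 :=
  \prod_t x 0 t ^+ e t.

Definition low_degree n : {set {ffun 'I_n -> 'I_3}} :=
  [set e : {ffun 'I_n -> 'I_3} | 3 * \sum_t (e t : nat) <= 2 * n]%N%SET.

Lemma delta_rV_expansion n (x y z : 'rV['F_3]_n) :
  (x + y + z == 0)%:R =
  \sum_(f : {ffun 'I_n -> 'I_3 * 'I_3 * 'I_3}) (\prod_t delta_coef (f t)) *
    (monomial x [ffun t => (f t).1.1] * monomial y [ffun t => (f t).1.2]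
     * monomial z [ffun t => (f t).2]).
Proof.
transitivity (\prod_t (x 0 t + y 0 t + z 0 t == 0)%:R : 'F_3).
  have [/rowP xyz0|xyz_neq0] := eqVneq (x + y + z) 0.
    by rewrite big1 // => t _; have := xyz0 t; rewrite !mxE => ->; rewrite eqxx.
  have [t xyzt] : exists t, (x + y + z) 0 t != 0.
    by apply/existsP; apply: contraNT xyz_neq0 => /existsPn xyz0; apply/eqP/rowP
      => t; rewrite [RHS]mxE; apply/eqP/negPn/xyz0.
  by rewrite (bigD1 t) //= !mxE in xyzt *; rewrite (negPf xyzt) mul0r.
under eq_bigr => t _ do rewrite delta_expansion.
(* Distributing the product over the sums: [f] picks one term of the expansion in each
   coordinate. *)
rewrite bigA_distr_bigA; apply: eq_bigr => f _; rewrite /monomial !big_split /=.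
by congr (_ * (_ * _ * _)); apply: eq_bigr => t _; rewrite ffunE.
Qed.

Lemma low_degree_trichotomy n (f : {ffun 'I_n -> 'I_3 * 'I_3 * 'I_3}) :
  \prod_t delta_coef (f t) != 0 ->
  [|| [ffun t => (f t).1.1] \in low_degree n,
      [ffun t => (f t).1.2] \in low_degree n
    | [ffun t => (f t).2] \in low_degree n].
Proof.
move=> /prodf_neq0 f_neq0; rewrite !inE.
have : (\sum_t ((f t).1.1 + (f t).1.2 + (f t).2) <= \sum_(t < n) 2)%N.
  by apply: leq_sum => t _; exact: delta_coef_neq0 (f_neq0 t isT).
rewrite !big_split /= sum_nat_const card_ord.
have degE (g : 'I_n -> 'I_3) :
    (\sum_t ([ffun t => g t] t : nat) = \sum_t (g t : nat))%N.
  by apply: eq_bigr => t _; rewrite ffunE.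
rewrite (degE (fun t => (f t).1.1)) (degE (fun t => (f t).1.2)).
rewrite (degE (fun t => (f t).2)).
set a := (\sum_t _)%N; set b := (\sum_t _)%N; set c := (\sum_t _)%N; lia.
Qed.

(** Since 2 = -1 in characteristic 3, a zero sum means z = x + 2(y - x), so x, y, z form a
    progression of difference y - x, which must then vanish. *)
Lemma ap3_free_sum0 n (A : {set 'rV['F_3]_n}) x y z :
  ap3_free A -> x \in A -> y \in A -> z \in A ->
  (x + y + z == 0) = (x == y) && (y == z).
Proof.
have char3 (v : 'rV['F_3]_n) : v *+ 3 = 0.
  by apply/rowP => t; rewrite mulmxnE mxE -mulr_natr pchar_Fp_0 ?mulr0.
have dblN (v : 'rV['F_3]_n) : v *+ 2 = - v.
  by apply/eqP; rewrite -addr_eq0 -mulrSr char3.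
move=> /forallP Afree xA yA zA; apply/idP/andP => [/eqP xyz0|[/eqP -> /eqP ->]].
  have zE : z = x + (y - x) *+ 2.
    apply/eqP; rewrite dblN opprB addrA -mulr2n dblN -opprD -addr_eq0 addrC.
    exact/eqP.
  have /forallP/(_ (y - x)) := Afree x.
  rewrite -zE (addrC x) subrK xA yA zA /= implybF negbK subr_eq0 => /eqP yx.
  by rewrite zE yx subrr mul0rn addr0 !eqxx.
by rewrite -mulr2n -mulrSr char3.
Qed.

Lemma ap3_free_card n (A : {set 'rV['F_3]_n}) :
  ap3_free A -> (#|A| <= 3 * #|low_degree n|)%N.
Proof.
move=> Afree; pose L := low_degree n.
pose E1 (f : {ffun 'I_n -> 'I_3 * 'I_3 * 'I_3}) := [ffun t => (f t).1.1].
pose E2 (f : {ffun 'I_n -> 'I_3 * 'I_3 * 'I_3}) := [ffun t => (f t).1.2].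
pose E3 (f : {ffun 'I_n -> 'I_3 * 'I_3 * 'I_3}) := [ffun t => (f t).2].
pose C (f : {ffun 'I_n -> 'I_3 * 'I_3 * 'I_3}) := \prod_t delta_coef (f t).
pose mono (x : 'I_#|A|) e := monomial (enum_val x) e.
(* Each term is charged to the first variable in which its degree is low, so that no term is counted
   twice. *)
pose P1 f := E1 f \in L.
pose P2 f := (E1 f \notin L) && (E2 f \in L).
pose P3 f := [&& E1 f \notin L, E2 f \notin L & E3 f \in L].
rewrite !mulSn mul0n addn0 addnA.
apply: (@slice_rank_diag 'F_3 #|A| #|L| #|L| #|L|
  (fun k x => mono x (enum_val k))
  (fun k y z => \sum_(f | P1 f && (E1 f == enum_val k))
     C f * mono y (E2 f) * mono z (E3 f))
  (fun k y => mono y (enum_val k))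
  (fun k x z => \sum_(f | P2 f && (E2 f == enum_val k))
     C f * mono x (E1 f) * mono z (E3 f))
  (fun k z => mono z (enum_val k))
  (fun k x y => \sum_(f | P3 f && (E3 f == enum_val k))
     C f * mono x (E1 f) * mono y (E2 f))) => x y z.
rewrite -!(inj_eq enum_val_inj) -(ap3_free_sum0 Afree) ?enum_valP //.
rewrite delta_rV_expansion -!sum_fiber; last 3 first.
- by move=> f /and3P[].
- by move=> f /andP[].
- by [].
rewrite (bigID P1) /= [X in _ + X = _](bigID (fun f => E2 f \in L)) /=.
rewrite [X in _ + (_ + X) = _](bigID (fun f => E3 f \in L)) /=.
(* The terms left over have high degree in all three variables, so their coefficient is zero. *)
rewrite [X in _ + (_ + (_ + X)) = _]big1 ?addr0 => [|f]; last first.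
  rewrite -andbA => /and3P[nL1 nL2 nL3].
  have [->|/low_degree_trichotomy] := eqVneq (\prod_t delta_coef (f t)) 0.
    by rewrite mul0r.
  by case/or3P => inL; [case/negP: nL1 | case/negP: nL2 | case/negP: nL3].
rewrite addrA; congr (_ + _ + _).
- by apply: eq_bigr => f _; rewrite /mono /C; ring.
- by apply: eq_bigr => f _; rewrite /mono /C; ring.
- apply: eq_big => f; first by rewrite /P3 andbA.
  by move=> _; rewrite /mono /C; ring.
Qed.

(* Rankin's trick: each low-degree e contributes at least y ^+ (2 * n) to
   \sum_e y ^+ (3 * \sum_t e t) = (1 + y ^+ 3 + y ^+ 6) ^+ n. *)
Lemma card_low_degree (R : realFieldType) n (y : R) : 0 < y <= 1 ->
  #|low_degree n|%:R <= ((1 + y ^+ 3 + y ^+ 6) / y ^+ 2) ^+ n.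
Proof.
move=> /andP[y_gt0 y_le1].
rewrite expr_div_n ler_pdivlMr ?exprn_gt0 // -exprM.
have -> : 1 + y ^+ 3 + y ^+ 6 = \sum_(j < 3) y ^+ (3 * j).
  by rewrite !big_ord_recl big_ord0 addr0 addrA.
rewrite -[n in X in _ <= X]card_ord -prodr_const bigA_distr_bigA /=.
rewrite [X in _ <= X](bigID (mem (low_degree n))) /=.
rewrite -sumr_const mulr_suml -[X in X <= _]addr0 lerD //.
  apply: ler_sum => e; rewrite inE mul1r -expr_sum -big_distrr /= => deg_e.
  by rewrite ler_wiXn2l // ltW.
by apply: sumr_ge0 => e _; apply: prodr_ge0 => t _; rewrite exprn_ge0 // ltW.
Qed.

Lemma r3_bound (R : realFieldType) n (y : R) : 0 < y <= 1 ->
  (r3 'rV['F_3]_n)%:R <= 3 * ((1 + y ^+ 3 + y ^+ 6) / y ^+ 2) ^+ n.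
Proof.
move=> y01; apply: le_trans (_ : (3 * #|low_degree n|)%N%:R <= _).
  by rewrite ler_nat; apply/bigmax_leqP => A; exact: ap3_free_card.
by rewrite natrM ler_wpM2l // card_low_degree.
Qed.

Theorem corollary5 (R : realType) :
  (r3 'rV['Z_3]_n)%:R / (2756%:R / 1000%:R) ^+ n @[n --> \oo] --> (0 : R).
Proof.
(* y ^+ 3 is close to the minimiser (sqrt 33 - 1) / 8 of
   (1 + x + x ^+ 2) / x `^ (2 / 3). *)
pose y : R := 21%:R / 25%:R.
have y01 : 0 < y <= 1 by rewrite /y; apply/andP; split; lra.
set c : R := 2756%:R / 1000%:R.
pose q : R := (1 + y ^+ 3 + y ^+ 6) / y ^+ 2 / c.
(* The base of the exponential bound is about 2.7551 at this [y], just below 2.756. *)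
have q01 : 0 <= q < 1 by rewrite /q /y /c; apply/andP; split; lra.
have c_gt0 : 0 < c by rewrite /c; lra.
clearbody c y.
apply: (@squeeze_cvgr _ _ _ _ (cst 0) (geometric 3 q)).
- apply: nearW => n; rewrite /= divr_ge0 ?exprn_ge0 ?(ltW c_gt0) //=.
  rewrite ler_pdivrMr ?exprn_gt0 // -mulrA -exprMn divfK ?gt_eqF //.
  (* ['F_3] stands for ['Z_(pdiv 3)], and [pdiv 3] computes to 3, so the bound applies to ['Z_3] by
     conversion. *)
  exact: r3_bound.
- exact: cvg_cst.
- by apply: cvg_geometric; rewrite ger0_norm; case/andP: q01.
Qed.
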